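(* Fix a prime $p$. Let $(\mathbf{A}_r)_{r\geq 0}$ be a sequence of maps from $\mathbb{N}$ to $\Omega\setminus\{0\}$ and $(\mathbf{g}_r)_{r\geq 0}$ a sequence of maps from $\mathbb{N}$ to $\mathcal{O}\setminus\{0\}$ such that, for all $r\geq 0$: (i) $|\mathbf{A}_r(0)|_p=1$; (ii) for all $m\in\mathbb{N}$, $\mathbf{A}_r(m)\in\mathbf{g}_r(m)\mathcal{O}$; and such that there exists $k_0\in\mathbb{N}$ for which: (iii) for all $m\in\mathbb{N}$ and all $r\geq 0$: if $v_p(m)\geq k_0$ then, for all $v,u,s\in\mathbb{N}$ with $v<p$ and $u<p^s$, $$\frac{\mathbf{A}_r(v+up+mp^{s+1})}{\mathbf{A}_r(v+up)}-\frac{\mathbf{A}_{r+1}(u+mp^{s})}{\mathbf{A}_{r+1}(u)}\in p^{s+k_0+1}\frac{\mathbf{g}_{r+s+1}(m)}{\mathbf{g}_r(v+up)}\mathcal{O};$$ and if $v_p(m)\leq k_0-1$ then $$\frac{\mathbf{A}_r(mp)}{\mathbf{A}_r(0)}-\frac{\mathbf{A}_{r+1}(m)}{\mathbf{A}_{r+1}(0)}\in p^{v_p(m)+1}\mathbf{g}_{r+1}(m)\mathcal{O};$$ (iv) for all $k\in\{1,\dots,k_0\}$, all $v\in\{1,\dots,p-1\}$, all $m\in\mathbb{N}$ and all $r\geq 0$, $\mathbf{g}_r(v+mp^{k})\in p^{k}\mathbf{g}_{r}(mp^k)\mathcal{O}$ and $\mathbf{g}_r(mp^{k})\in\mathbf{g}_{r+k}(m)\mathcal{O}$.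 Then, for all $a\in\{0,\dots,p-1\}$, all $m,s\in\mathbb{N}$, all $r\geq 0$ and all $K\in\mathbb{Z}$, $$\mathbf{S}_r(a,K,s,p,m):=\sum_{j=mp^s}^{(m+1)p^s-1}\Big(\mathbf{A}_r(a+p(K-j))\mathbf{A}_{r+1}(j)-\mathbf{A}_{r+1}(K-j)\mathbf{A}_r(a+jp)\Big)\in p^{s+1}\mathbf{g}_{s+r+1}(m)\mathcal{O},$$ where one sets $\mathbf{A}_r(\ell)=0$ for all $r\ge 0$ and all integers $\ell<0$.
   Context: $\mathbb{N}=\{0,1,2,\dots\}$. $\Omega$ is the completion of the algebraic closure of $\mathbb{Q}_p$, $|\cdot|_p$ its absolute value, and $\mathcal{O}$ is the ring of integers of $\Omega$. $v_p$ is the $p$-adic valuation, with $v_p(0)=+\infty$. *)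

(* Defs.v *)
From HB Require Import structures.
From mathcomp Require Import all_boot all_order all_algebra.
From mathcomp Require Import reals.

Set Implicit Arguments.
Unset Strict Implicit.
Unset Printing Implicit Defensive.

Import Order.TTheory GRing.Theory Num.Theory.
Local Open Scope ring_scope.

(* The normed structures of the libraries require [`|x *+ n| = `|x| *+ n],
   which excludes p-adic absolute values; absolute values are therefore plain
   functions to the reals. *)
Record nonarch_abs (R : realType) (K : fieldType) (abs : K -> R) : Prop := {
  nabs_ge0 : forall x, 0 <= abs x;
  nabs_eq0 : forall x, abs x = 0 <-> x = 0;
  nabsM : forall x y, abs (x * y) = abs x * abs y;
  nabsD : forall x y, abs (x + y) <= Num.max (abs x) (abs y)
}.

Definition abs_complete (R : realType) (K : fieldType) (abs : K -> R) : Prop :=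
  forall u : nat -> K,
    (forall e : R, 0 < e -> exists N : nat,
       forall i j : nat, (N <= i)%N -> (N <= j)%N -> abs (u i - u j) < e) ->
    exists l : K, forall e : R, 0 < e -> exists N : nat,
       forall i : nat, (N <= i)%N -> abs (u i - l) < e.

Record is_completion (R : realType) (K L : fieldType)
    (absK : K -> R) (absL : L -> R) (f : {rmorphism K -> L}) : Prop := {
  completion_abs : nonarch_abs absL;
  completion_isometry : forall x, absL (f x) = absK x;
  completion_dense : forall (y : L) (e : R), 0 < e ->
    exists x : K, absL (y - f x) < e;
  completion_complete : abs_complete absL
}.

Record is_alg_closure (K L : fieldType) (f : {rmorphism K -> L}) : Prop := {
  alg_closure_algebraic : forall y : L, algebraicOver f y;
  alg_closure_closed : GRing.closed_field_axiom L
}.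

(* |x|_p = p^(- v_p(x)), where v_p(x) = v_p(numerator) - v_p(denominator). *)
Definition padic_abs (R : realType) (p : nat) (x : rat) : R :=
  if x == 0 then 0
  else (p%:R : R) ^ ((logn p `|denq x|)%:Z - (logn p `|numq x|)%:Z).

(* (Om, abs) is the completion of an algebraic closure of Q_p, which is itself
   the completion of the rationals for |.|_p; this determines (Om, abs) up to
   isometric isomorphism.  The absolute value of the algebraic closure is the
   one extending that of Q_p. *)
Definition is_Omega (R : realType) (p : nat) (Om : fieldType) (abs : Om -> R)
    : Prop :=
  exists (Qp : fieldType) (absQp : Qp -> R) (iQ : {rmorphism rat -> Qp})
         (Qpbar : fieldType) (absQpbar : Qpbar -> R)
         (iQp : {rmorphism Qp -> Qpbar}) (iQpbar : {rmorphism Qpbar -> Om}),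
    [/\ is_completion (@padic_abs R p) absQp iQ,
        is_alg_closure iQp,
        nonarch_abs absQpbar,
        (forall x, absQpbar (iQp x) = absQp x) &
        is_completion absQpbar abs iQpbar].

(* x \in y O, where O = {z | abs z <= 1} is the ring of integers *)
Definition in_mulO (R : realType) (Om : fieldType) (abs : Om -> R) (y x : Om)
    : Prop :=
  exists2 z : Om, abs z <= 1 & x = y * z.

(* v_p(m) >= k with v_p(0) = +oo, whereas [logn p 0 = 0].  The condition
   v_p(m) <= k - 1 is its negation. *)
Definition vp_geq (p k m : nat) : bool := (m == 0%N) || (k <= logn p m)%N.

(* Extension of A to the integers by 0 on the negative ones. *)
Definition ext0 (Om : fieldType) (A : nat -> Om) (l : int) : Om :=
  match l with Posz n => A n | Negz _ => 0 end.

Definition Ssum (Om : fieldType) (A : nat -> nat -> Om)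
    (r a : nat) (K : int) (s p m : nat) : Om :=
  \sum_(m * p ^ s <= j < m.+1 * p ^ s)
    (ext0 (A r) (a%:Z + p%:Z * (K - j%:Z)) * A r.+1 j
     - ext0 (A r.+1) (K - j%:Z) * A r (a + j * p)%N).

(* Main.v *)
Require Import Defs.
From HB Require Import structures.
From mathcomp Require Import all_boot all_order all_algebra.
From mathcomp Require Import reals ring zify.

Set Implicit Arguments.
Unset Strict Implicit.
Unset Printing Implicit Defensive.

Import Order.TTheory GRing.Theory Num.Theory.
Local Open Scope ring_scope.

(** Dwork's method. Write S_r(K, s, m) for the sum to be bounded, with a fixed,
    and call the bound on it, over all r, K and m, the bound at level s. It is
    proved by strong induction on s.

    The engine is antisymmetry: exchanging j and K - j shows that the S_r(K, s, m)
    add up to 0 over all m ([sum_Ssum_eq0]). Suppose that, up to the target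
    precision p^(s+1) g_{r+s+1}(m), every S_r(K + m p^s, s, m) is proportional to
    S_r(K, s, 0), with a coefficient in g_{r+s+1}(m) O
    ([Ssum_shift_proportional]). The vanishing sum then expresses S_r(K, s, 0)
    through the S_r(K', s, 0) with K' < K; these vanish for K' < 0, so
    S_r(K, s, 0) lies in p^(s+1) O by induction on K, and proportionality gives
    the bound at level s ([Ssum_bound]).

    When p^k0 divides m, proportionality is Dwork's argument
    ([Ssum_shift_partial]): start from the terms of the sum and replace the
    ratios A_{r+t+1}(j + m p^(s-t)) / A_{r+t+1}(j), one digit of j at a time, by
    ratios in which that digit is gone. The bound at level t < s makes each
    replacement harmless. After s replacements a single ratio is left, which
    factors out.

    When p^k0 does not divide m, split the sum of level s into the p sums of
    level s - 1 with indices i + p m. For i > 0 the divisibility of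
    g(i + p m) together with the bound at level s - 1 makes them negligible, at
    m as well as at 0 ([Ssum_nondivisible_blocks_dv]), and there remains the
    index p m at level s - 1, whose valuation is one higher. This ends either at
    an index divisible by p^k0 or at level 0, where the congruence for indices of
    low valuation concludes ([Ssum0_shift_vp_lt]). *)

(** * Regrouping sums by digits *)

Lemma sum_nat_blocks (V : nmodType) (F : nat -> V) (n m k : nat) :
  \sum_(m * n <= j < (k + m) * n) F j =
  \sum_(i < k) \sum_((i + m) * n <= j < (i + m).+1 * n) F j.
Proof.
elim: k => [|k IHk]; first by rewrite big_ord0 big_geq.
rewrite big_ord_recr /= -IHk.
by rewrite (@big_cat_nat _ _ _ ((k + m) * n)%N) //= leq_mul2r; lia.
Qed.

Lemma sum_ord_digits (V : nmodType) (F : nat -> V) (n k : nat) :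
  \sum_(j < k * n) F j = \sum_(u < k) \sum_(i < n) F (i + u * n)%N.
Proof.
rewrite -(big_mkord xpredT F) /= -{1}[k]addn0 -{1}(mul0n n) sum_nat_blocks.
apply: eq_bigr => u _; rewrite addn0 -{1}[(u * n)%N]add0n big_addn mulSn addnK.
by rewrite big_mkord.
Qed.

(** * Divisibility in the valuation ring *)

Section Integrality.

Context (R : realType) (Om : fieldType) (abs : Om -> R).
Context (absP : nonarch_abs abs).

Local Notation dv := (in_mulO abs).

Lemma nabs0 : abs 0 = 0. Proof. exact/(nabs_eq0 absP). Qed.

Lemma nabs1 : abs 1 = 1.
Proof.
have /eqP : abs 1 * abs 1 = abs 1 * 1 by rewrite -(nabsM absP) !mulr1.
rewrite -subr_eq0 -mulrBr mulf_eq0 subr_eq0 => /orP[/eqP|/eqP//].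
by move/(nabs_eq0 absP)/eqP; rewrite oner_eq0.
Qed.

Lemma nabsN x : abs (- x) = abs x.
Proof.
rewrite -mulN1r (nabsM absP); suff -> : abs (-1) = 1 by rewrite mul1r.
apply/eqP; rewrite -(@eqrXn2 _ 2) ?(nabs_ge0 absP) //.
by rewrite expr2 -(nabsM absP) mulrNN mulr1 nabs1 expr1n.
Qed.

Lemma dv1P x : dv 1 x <-> abs x <= 1.
Proof.
split; first by case=> z zO ->; rewrite mul1r.
by move=> xO; exists x; rewrite ?mul1r.
Qed.

Lemma dv_refl x : dv x x.
Proof. by exists 1; rewrite ?mulr1 ?nabs1. Qed.

Lemma dv0 x : dv x 0.
Proof. by exists 0; rewrite ?mulr0 ?nabs0. Qed.

Lemma dvM x y x' y' : dv x y -> dv x' y' -> dv (x * x') (y * y').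
Proof.
move=> [z zO ->] [z' zO' ->]; exists (z * z'); last by rewrite mulrACA.
by rewrite (nabsM absP) mulr_ile1 ?(nabs_ge0 absP).
Qed.

Lemma dv_mulr x y z : dv x y -> dv 1 z -> dv x (y * z).
Proof. by move=> xy zO; rewrite -[x]mulr1; apply: dvM. Qed.

Lemma dv_mull x y z : dv x y -> dv 1 z -> dv x (z * y).
Proof. by rewrite mulrC; apply: dv_mulr. Qed.

Lemma dv_trans y x z : dv x y -> dv y z -> dv x z.
Proof. by move=> xy [w wO ->]; apply: dv_mulr => //; apply/dv1P. Qed.

Lemma dvD x y z : dv x y -> dv x z -> dv x (y + z).
Proof.
move=> [y' yO ->] [z' zO ->]; exists (y' + z'); last by rewrite mulrDr.
by rewrite (le_trans (nabsD absP _ _)) // ge_max yO.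
Qed.

Lemma dvN x y : dv x y -> dv x (- y).
Proof. by case=> y' yO ->; exists (- y'); rewrite ?mulrN ?nabsN. Qed.

Lemma dvB x y z : dv x y -> dv x z -> dv x (y - z).
Proof. by move=> xy xz; apply: dvD => //; apply: dvN. Qed.

Lemma dv_sum I (r : seq I) (P : pred I) (F : I -> Om) x :
  (forall i, P i -> dv x (F i)) -> dv x (\sum_(i <- r | P i) F i).
Proof. by move=> xF; apply: big_ind => //; [exact: dv0 | exact: dvD]. Qed.

Lemma dv1_nat n : dv 1 n%:R.
Proof.
elim: n => [|n IHn]; first exact: dv0.
by rewrite -natr1; apply: dvD => //; apply: dv_refl.
Qed.

Lemma dv1X x n : dv 1 x -> dv 1 (x ^+ n).
Proof.
move=> xO; elim: n => [|n IHn]; first exact: dv_refl.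
by rewrite exprS; apply: dv_mulr.
Qed.

Lemma dv_natX q m n : (m <= n)%N -> dv (q%:R ^+ m) (q%:R ^+ n).
Proof.
move=> /subnKC <-; rewrite exprD; apply: dv_mulr; first exact: dv_refl.
exact/dv1X/dv1_nat.
Qed.

End Integrality.

Section Dwork.

Context (R : realType) (p : nat) (p_prime : prime p).
Context (Om : fieldType) (abs : Om -> R) (absP : nonarch_abs abs).
Context (A g : nat -> nat -> Om).

Local Notation dv := (in_mulO abs).
Local Notation S r a K s m := (Ssum A r a K s p m).

Let p_gt0 : (0 < p)%N := prime_gt0 p_prime.

(** * The sums and their antisymmetry *)

Lemma Ssum0 r a K m :
  S r a K 0 m = ext0 (A r) (a%:Z + p%:Z * (K - m%:Z)) * A r.+1 m
                - ext0 (A r.+1) (K - m%:Z) * A r (a + m * p)%N.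
Proof. by rewrite /Ssum expn0 !muln1 big_nat1. Qed.

Lemma SsumE r a K s m :
  S r a K s m = \sum_(j < p ^ s) S r a K 0 (j + m * p ^ s).
Proof.
rewrite {1}/Ssum -{1}[(m * p ^ s)%N]add0n big_addn mulSn addnK big_mkord.
by apply: eq_bigr => j _; rewrite Ssum0.
Qed.

Lemma SsumS r a K s m : S r a K s.+1 m = \sum_(i < p) S r a K s (i + m * p).
Proof.
rewrite SsumE expnS (sum_ord_digits (fun j => S r a K 0 (j + m * (p * p ^ s)))).
by apply: eq_bigr => i _; rewrite SsumE; apply: eq_bigr => j _; congr Ssum; nia.
Qed.

(** With K translated by m p^s, the arguments K - j of the other two factors no
    longer depend on m, so sums with different m become comparable. *)
Lemma Ssum_shift r a (K : int) s m :
  S r a (K + (m * p ^ s)%:Z) s m = \sum_(j < p ^ s)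
    (ext0 (A r) (a%:Z + p%:Z * (K - j%:Z)) * A r.+1 (j + m * p ^ s)%N
     - ext0 (A r.+1) (K - j%:Z) * A r (a + j * p + m * p ^ s.+1)%N).
Proof.
rewrite SsumE; apply: eq_bigr => j _; rewrite Ssum0.
have -> : K + (m * p ^ s)%:Z - (j + m * p ^ s)%:Z = K - j%:Z by lia.
by rewrite expnS; congr (_ - _ * A r _); nia.
Qed.

Lemma Ssum_neg r a (K : int) s : (a < p)%N -> K < 0 -> S r a K s 0 = 0.
Proof.
move=> ap K0; rewrite SsumE big1 // => j _; rewrite Ssum0.
have neg l : l < 0 -> ext0 (A r) l = 0 /\ ext0 (A r.+1) l = 0 by case: l.
have jK : K - (j + 0 * p ^ s)%:Z < 0 by lia.
have [_ ->] := neg _ jK.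
have [|-> _] := neg (a%:Z + p%:Z * (K - (j + 0 * p ^ s)%:Z)); first nia.
by rewrite !mul0r subrr.
Qed.

(** The whole sum over j <= K is antisymmetric under the exchange of j and
    K - j. The blocks m <= K cover these j; the terms with j > K vanish. *)
Lemma sum_Ssum_eq0 r a (K s : nat) : (a < p)%N ->
  \sum_(m < K.+1) S r a K%:Z s m = 0.
Proof.
move=> ap; pose F j := S r a K 0 j.
have -> : \sum_(m < K.+1) S r a K s m = \sum_(j < K.+1 * p ^ s) F j.
  by rewrite sum_ord_digits; apply: eq_bigr => m _; rewrite SsumE.
have neg B l : l < 0 -> ext0 B l = 0 :> Om by case: l.
have KN : (K.+1 <= K.+1 * p ^ s)%N by rewrite leq_pmulr // expn_gt0 p_gt0.
rewrite -(big_mkord xpredT F) (@big_cat_nat _ _ _ K.+1) //=.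
rewrite [X in _ + X]big_nat [X in _ + X]big1 ?addr0; last first.
  move=> j /andP[Kj _]; rewrite /F Ssum0 !neg ?mul0r ?subrr //; [lia|nia].
rewrite big_mkord /F.
under eq_bigr => j _ do rewrite Ssum0.
rewrite sumrB; apply/eqP; rewrite subr_eq0; apply/eqP.
rewrite (reindex_inj rev_ord_inj) /=; apply: eq_bigr => j _.
rewrite subSS; have jK : (j <= K)%N by rewrite -ltnS ltn_ord.
have -> : a%:Z + p%:Z * (K%:Z - (K - j)%:Z) = (a + j * p)%:Z by nia.
have -> : K%:Z - j%:Z = (K - j)%:Z by lia.
by rewrite /= mulrC.
Qed.

(** * Indices divisible by p^k0 *)

Context (A_neq0 : forall r m, A r m != 0) (g_neq0 : forall r m, g r m != 0).
Context (g_int : forall r m, abs (g r m) <= 1).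
Context (A0_unit : forall r, abs (A r 0%N) = 1).
Context (A_dv : forall r m, dv (g r m) (A r m)).
Context (k0 : nat).
Context (ratio_cong : forall m r : nat, vp_geq p k0 m ->
   forall v u s : nat, (v < p)%N -> (u < p ^ s)%N ->
   dv (p%:R ^+ (s + k0 + 1) * (g (r + s + 1)%N m / g r (v + u * p)%N))
      (A r (v + u * p + m * p ^ (s + 1))%N / A r (v + u * p)%N
       - A (r + 1)%N (u + m * p ^ s)%N / A (r + 1)%N u)).
Context (ratio_cong_vp_lt : forall m r : nat, ~~ vp_geq p k0 m ->
   dv (p%:R ^+ (logn p m + 1) * g (r + 1)%N m)
      (A r (m * p)%N / A r 0%N - A (r + 1)%N m / A (r + 1)%N 0%N)).
Context (g_digit : forall k v m r : nat,
   (1 <= k <= k0)%N -> (1 <= v <= p - 1)%N ->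
   dv (p%:R ^+ k * g r (m * p ^ k)%N) (g r (v + m * p ^ k)%N) /\
   dv (g (r + k)%N m) (g r (m * p ^ k)%N)).

Lemma vp_geqE m : vp_geq p k0 m = (p ^ k0 %| m)%N.
Proof.
rewrite /vp_geq; case: m => [|m]; first by rewrite dvdn0.
by rewrite pfactor_dvdn.
Qed.

Lemma dv1_g r m : dv 1 (g r m). Proof. exact/dv1P. Qed.

Lemma dv1_ext0 r l : dv 1 (ext0 (A r) l).
Proof.
case: l => n /=; last exact: dv0.
exact: (dv_trans absP (dv1_g r n) (A_dv r n)).
Qed.

Lemma dv1_invA0 r : dv 1 (A r 0%N)^-1.
Proof.
apply/dv1P; suff -> : abs (A r 0%N)^-1 = 1 by [].
by rewrite -[LHS]mul1r -(A0_unit r) -(nabsM absP) mulfV ?nabs1.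
Qed.

Definition Ssum_dv s := forall r a m (K : int), (a < p)%N ->
  dv (p%:R ^+ s.+1 * g (r + s).+1 m) (S r a K s m).

(** The congruence between ratios, multiplied by some x that absorbs its
    denominator g_r(v + u p): this is how one digit is removed from a ratio. *)
Lemma ratio_dv h q r v u s m (x : Om) :
  vp_geq p k0 m -> (v < p)%N -> (u < p ^ s)%N ->
  dv (q * g r (v + u * p)%N) x -> h = (s + k0).+1 ->
  dv (q * (p%:R ^+ h * g (r + s).+1 m))
    (A r (v + u * p + m * p ^ s.+1)%N / A r (v + u * p)%N * x
     - A r.+1 (u + m * p ^ s)%N / A r.+1 u * x).
Proof.
move=> mk vp us dvx ->; rewrite -mulrBl.
have := dvM absP (ratio_cong r mk vp us) dvx.
rewrite !addn1 mulrA; congr (in_mulO abs _ _).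
by move: (g_neq0 r (v + u * p)) => g0; field.
Qed.

(** Induction on t: t = 0 compares the terms one by one, and each further step
    removes the lowest digit from the indices j of the ratios. The step costs an
    error p^(d+k0+1) from the ratios times p^(t+1) from the bound at level t,
    a total that depends only on the level t + 1 + d of the left-hand sum. *)
Lemma Ssum_shift_partial r a (K : int) t d m :
  (a < p)%N -> vp_geq p k0 m -> (forall u, (u < t)%N -> Ssum_dv u) ->
  dv (p%:R ^+ (t + d + k0).+1 * g (r + (t + d)).+1 m)
    (S r a (K + (m * p ^ (t + d))%:Z) (t + d) m
     - \sum_(j < p ^ d)
         A (r + t).+1 (j + m * p ^ d)%N / A (r + t).+1 j * S r a K t j).
Proof.
move=> ap mk; elim: t d => [|t IHt] d ltS.
  rewrite add0n addn0 Ssum_shift -sumrB; apply: (dv_sum absP) => // j _.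
  set Y := ext0 (A r.+1) (K - j%:Z).
  have : dv (1 * g r (a + j * p)%N) (Y * A r (a + j * p)%N).
    by rewrite mul1r; apply: (dv_mull absP) => //; exact: dv1_ext0.
  move/(ratio_dv mk ap (ltn_ord j))/(_ (erefl _))/(dvN absP).
  rewrite mul1r Ssum0 -/Y; congr (in_mulO abs _ _).
  move: (A_neq0 r (a + j * p)) (A_neq0 r.+1 j) => nz1 nz2.
  by field; rewrite nz2.
have ltS' u : (u < t)%N -> Ssum_dv u.
  by move=> ut; apply: ltS; rewrite ltnS ltnW.
have IH := IHt d.+1 ltS'; rewrite -(addSnnS t d) in IH.
have step : dv (p%:R ^+ (t.+1 + d + k0).+1 * g (r + (t.+1 + d)).+1 m)
  (\sum_(j < p ^ d.+1)
      A (r + t).+1 (j + m * p ^ d.+1)%N / A (r + t).+1 j * S r a K t j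
   - \sum_(u < p ^ d)
      A (r + t.+1).+1 (u + m * p ^ d)%N / A (r + t.+1).+1 u * S r a K t.+1 u).
  rewrite expnSr (sum_ord_digits (fun j => A (r + t).+1 (j + m * (p ^ d * p))%N
    / A (r + t).+1 j * S r a K t j)) -sumrB -expnSr.
  apply: (dv_sum absP) => // u _; rewrite SsumS mulr_sumr -sumrB.
  apply: (dv_sum absP) => // i _.
  have dvS := ltS t (ltnSn t) r a (i + u * p)%N K ap.
  have := ratio_dv mk (ltn_ord i) (ltn_ord u) dvS (erefl _).
  have -> : (r + t.+1 = (r + t).+1)%N by rewrite addnS.
  rewrite mulrA -exprD; congr (in_mulO abs (_ * g _ _) _); last by lia.
  by congr (_ ^+ _); lia.
by have := dvD absP IH step; rewrite addrA subrK.
Qed.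

Lemma Ssum_shift_proportional_vp_geq r a (K : int) s m e :
  (a < p)%N -> (forall u, (u < s)%N -> Ssum_dv u) ->
  (e <= k0)%N -> vp_geq p k0 m ->
  exists2 c, dv (g (r + s).+1 m) c &
    dv (p%:R ^+ (s + e).+1 * g (r + s).+1 m)
       (S r a (K + (m * p ^ s)%:Z) s m - c * S r a K s 0).
Proof.
move=> ap ltS ek mk; exists (A (r + s).+1 m / A (r + s).+1 0).
  by apply: (dv_mulr absP) => //; apply: dv1_invA0.
have := Ssum_shift_partial r K 0 ap mk ltS.
rewrite !addn0 expn0 big_ord1 muln1 add0n; apply: (dv_trans absP).
apply: (dvM absP); last exact: dv_refl.
by apply: (dv_natX absP); rewrite ltnS leq_add2l.
Qed.

(** * Indices not divisible by p^k0 *)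

Lemma g_mulp r m : (0 < k0)%N -> dv (g r.+1 m) (g r (m * p)%N).
Proof.
move=> k0_gt0; have p1 := prime_gt1 p_prime.
have [||_] := @g_digit 1 1 m r; [lia|lia|].
by rewrite addn1 expn1.
Qed.

Lemma g_add_digit r v e M : (0 < v < p)%N -> (e < k0)%N -> (p ^ e.+1 %| M)%N ->
  dv (p%:R ^+ e.+1 * g r M) (g r (v + M)%N).
Proof.
move=> vp ek /dvdnP[M' ->].
by have [||] := @g_digit e.+1 v M' r; [lia | lia |].
Qed.

(** The parts with A_{r+1}(m) cancel, which leaves the combination
    c A_r(a) - A_r(a + m p). It is controlled by the hypothesis on low valuations
    when a = 0; otherwise both of its terms are small separately, a being a
    nonzero digit in front of a multiple of p^(v_p(m)+1). *)
Lemma Ssum0_shift_vp_lt r a (K : int) m :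
  (a < p)%N -> ~~ vp_geq p k0 m ->
  dv (p%:R ^+ (logn p m).+1 * g r.+1 m)
     (S r a (K + m%:Z) 0 m - A r.+1 m / A r.+1 0 * S r a K 0 0).
Proof.
move=> ap mk; have k0m : (logn p m < k0)%N.
  by move: mk; rewrite /vp_geq negb_or -ltnNge => /andP[].
have k0_gt0 : (0 < k0)%N by exact: leq_ltn_trans k0m.
have := Ssum_shift r a K 0 m; rewrite expn0 muln1 expn1 big_ord1 => ->.
rewrite Ssum0 /= !add0n !mul0n !addn0 subr0.
set c := A r.+1 m / A r.+1 0; set Y := ext0 (A r.+1) K.
have -> : ext0 (A r) (a%:Z + p%:Z * K) * A r.+1 m - Y * A r (a + m * p)%N
   - c * (ext0 (A r) (a%:Z + p%:Z * K) * A r.+1 0 - Y * A r a)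
   = Y * (c * A r a - A r (a + m * p)%N).
  by rewrite /c; have A10 := A_neq0 r.+1 0; field.
apply: (dv_mull absP); last exact: dv1_ext0.
have c_dv : dv (g r.+1 m) c by apply: (dv_mulr absP) => //; apply: dv1_invA0.
have [a0|a_neq0] := eqVneq a 0%N.
  have A00 := A_neq0 r 0.
  have -> : c * A r a - A r (a + m * p)%N
      = - ((A r (m * p)%N / A r 0%N - c) * A r 0%N).
    by rewrite a0 add0n; field.
  apply/(dvN absP)/(dv_mulr absP); last by apply/dv1P; rewrite A0_unit.
  by have := ratio_cong_vp_lt r mk; rewrite !addn1.
have va : (0 < a < p)%N by rewrite lt0n a_neq0.
apply: (dvB absP).
  rewrite mulrC; apply: (dvM absP) => //.
  apply: (dv_trans absP) (A_dv r a).
  have := g_add_digit r va k0m (dvdn0 _); rewrite addn0.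
  by apply: (dv_trans absP); apply: (dv_mulr absP (dv_refl absP _) (dv1_g r 0)).
apply: (dv_trans absP) (A_dv _ _).
have := g_add_digit (M := m * p) r va k0m.
rewrite expnSr dvdn_mul ?pfactor_dvdnn // => /(_ isT).
apply: (dv_trans absP); apply: (dvM absP); [exact: dv_refl | exact: g_mulp].
Qed.

(** For a digit i > 0, the factor p^(e+1) in g(i + p m) makes up for the level
    lost in passing from s + 1 to s. *)
Lemma Ssum_nondivisible_blocks_dv r a (K : int) s m e :
  (a < p)%N -> Ssum_dv s -> (e < k0)%N -> (p ^ e %| m)%N ->
  dv (p%:R ^+ (s.+1 + e).+1 * g (r + s).+1 (m * p))
     (S r a K s.+1 m - S r a K s (m * p)).
Proof.
move=> ap dvS ek em; have p1 := prime_gt1 p_prime.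
have pE : p = p.-1.+1 by rewrite prednK.
rewrite SsumS [in X in X - _]pE big_ord_recl /= add0n -pE addrC addKr.
apply: (dv_sum absP) => i _; set v := bump 0 i.
have vp : (0 < v < p)%N by rewrite /v /bump; have := ltn_ord i; lia.
apply: (dv_trans absP) (dvS r a _ K ap).
rewrite -addnS exprD -mulrA; apply: (dvM absP); first exact: dv_refl.
by apply: g_add_digit => //; rewrite expnSr dvdn_mul.
Qed.

(** The parameter e makes the induction on s go through: passing from (s+1, m) to
    (s, p m) preserves s + e, hence the precision. The coefficient c is only known
    to exist, because it is the ratio attached to the last index p^l m that the
    descent reaches. *)
Lemma Ssum_shift_proportional r a (K : int) s m e :
  (a < p)%N -> (forall u, (u < s)%N -> Ssum_dv u) ->
  (e <= k0)%N -> (p ^ e %| m)%N ->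
  exists2 c, dv (g (r + s).+1 m) c &
    dv (p%:R ^+ (s + e).+1 * g (r + s).+1 m)
       (S r a (K + (m * p ^ s)%:Z) s m - c * S r a K s 0).
Proof.
move=> ap; elim: s m e => [|s IHs] m e ltS ek em;
  (have [mk|mk] := boolP (vp_geq p k0 m);
    first exact: Ssum_shift_proportional_vp_geq).
  exists (A r.+1 m / A r.+1 0).
    by rewrite addn0; apply: (dv_mulr absP) => //; apply: dv1_invA0.
  rewrite expn0 muln1 add0n addn0.
  apply: (dv_trans absP) (Ssum0_shift_vp_lt r K ap mk).
  apply: (dvM absP); last exact: dv_refl.
  apply: (dv_natX absP); rewrite ltnS -pfactor_dvdn //.
  by move: mk; rewrite /vp_geq negb_or lt0n => /andP[].
have lt_ek : (e < k0)%N.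
  rewrite ltn_neqAle ek andbT; apply: contra mk => /eqP ek0.
  by rewrite vp_geqE -ek0.
have k0_gt0 : (0 < k0)%N by exact: leq_ltn_trans lt_ek.
have ltS' u : (u < s)%N -> Ssum_dv u.
  by move=> us; apply: ltS; rewrite ltnS ltnW.
have [|c c_dv IH] := IHs (m * p)%N e.+1 ltS' lt_ek.
  by rewrite expnSr dvdn_mul.
have gmp : dv (g (r + s.+1).+1 m) (g (r + s).+1 (m * p)%N).
  by rewrite addnS; exact: g_mulp.
have c_dvm := dv_trans absP gmp c_dv.
exists c => //.
have Em : (m * p * p ^ s = m * p ^ s.+1)%N by rewrite expnS mulnA.
rewrite Em addnS in IH.
have blk (L : int) n (en : (p ^ e %| n)%N) :=
  Ssum_nondivisible_blocks_dv r L ap (ltS s (ltnSn s)) lt_ek en.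
have to_m x : dv (p%:R ^+ (s.+1 + e).+1 * g (r + s).+1 (m * p)%N) x ->
    dv (p%:R ^+ (s.+1 + e).+1 * g (r + s.+1).+1 m) x.
  by apply: (dv_trans absP); apply: (dvM absP) => //; apply: dv_refl.
have blk0 : dv (p%:R ^+ (s.+1 + e).+1 * g (r + s.+1).+1 m)
    (c * (S r a K s.+1 0 - S r a K s 0)).
  rewrite mulrC; apply: (dvM absP) => //.
  apply: (dv_trans absP) (blk K _ (dvdn0 _)).
  by rewrite mul0n; apply: (dv_mulr absP (dv_refl absP _)); apply: dv1_g.
have blkm := to_m _ (blk (K + (m * p ^ s.+1)%:Z) _ em).
have := dvB absP (dvD absP blkm (to_m _ IH)) blk0.
congr (in_mulO abs _ _); ring.
Qed.

(** * The bound at every level *)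

Lemma Ssum_bound s : Ssum_dv s.
Proof.
have [n le_sn] := ubnP s; elim: n s le_sn => // n IHn s le_sn.
have ltS u : (u < s)%N -> Ssum_dv u by move=> us; apply: IHn; lia.
have prop r a (K : int) m (ap : (a < p)%N) :=
  Ssum_shift_proportional r K ap ltS (leq0n k0) (dvd1n m).
have dvK0 r a (K : int) : (a < p)%N -> dv (p%:R ^+ s.+1) (S r a K s 0).
  move=> ap; case: K => [K|K]; last by rewrite Ssum_neg //; exact: dv0.
  have [N le_KN] := ubnP K; elim: N K le_KN => // N IHK K le_KN.
  (* Isolate the block m = 0 in the vanishing sum. *)
  have /eqP := sum_Ssum_eq0 r K s ap.
  rewrite big_ord_recl /= addr_eq0 => /eqP ->.
  apply/(dvN absP)/(dv_sum absP) => i _; set m := bump 0 i.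
  have [c c_dv] := prop r a (K%:Z - (m * p ^ s)%:Z) m ap.
  rewrite subrK addn0 => dvS.
  rewrite -[S r a K s m](subrK (c * S r a (K%:Z - (m * p ^ s)%:Z) s 0)).
  apply: (dvD absP).
    apply: (dv_trans absP) dvS.
    by apply: (dv_mulr absP (dv_refl absP _)); apply: dv1_g.
  apply: (dv_mull absP); last exact: dv_trans (dv1_g _ _) c_dv.
  have : (0 < m * p ^ s)%N by rewrite muln_gt0 expn_gt0 p_gt0.
  case: (leqP (m * p ^ s) K) => [le_mK|lt_Km] m_gt0.
    by rewrite subzn //; apply: IHK; lia.
  by rewrite Ssum_neg; [exact: dv0 | | lia].
move=> r a m K ap; have [c c_dv] := prop r a (K - (m * p ^ s)%:Z) m ap.
rewrite subrK addn0 => dvS.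
rewrite -[S r a K s m](subrK (c * S r a (K - (m * p ^ s)%:Z) s 0)).
apply: (dvD absP) => //; rewrite mulrC.
by apply: (dvM absP) => //; apply: dvK0.
Qed.

End Dwork.

Theorem mainTheorem3 (R : realType) (p : nat) (p_prime : prime p)
    (Om : fieldType) (abs : Om -> R) (Om_p : is_Omega p abs)
    (A g : nat -> nat -> Om)
    (A_neq0 : forall r m : nat, A r m != 0)
    (g_neq0 : forall r m : nat, g r m != 0)
    (g_int : forall r m : nat, abs (g r m) <= 1)
    (hi : forall r : nat, abs (A r 0%N) = 1)
    (hii : forall r m : nat, in_mulO abs (g r m) (A r m))
    (k0 : nat)
    (hiii_ge : forall m r : nat, vp_geq p k0 m ->
       forall v u s : nat, (v < p)%N -> (u < p ^ s)%N ->
       in_mulO abs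
         (p%:R ^+ (s + k0 + 1) * (g (r + s + 1)%N m / g r (v + u * p)%N))
         (A r (v + u * p + m * p ^ (s + 1))%N / A r (v + u * p)%N
          - A (r + 1)%N (u + m * p ^ s)%N / A (r + 1)%N u))
    (hiii_lt : forall m r : nat, ~~ vp_geq p k0 m ->
       in_mulO abs
         (p%:R ^+ (logn p m + 1) * g (r + 1)%N m)
         (A r (m * p)%N / A r 0%N - A (r + 1)%N m / A (r + 1)%N 0%N))
    (hiv : forall k v m r : nat,
       (1 <= k <= k0)%N -> (1 <= v <= p - 1)%N ->
       in_mulO abs (p%:R ^+ k * g r (m * p ^ k)%N) (g r (v + m * p ^ k)%N) /\
       in_mulO abs (g (r + k)%N m) (g r (m * p ^ k)%N)) :
  forall (a m s r : nat) (K : int), (a <= p - 1)%N ->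
    in_mulO abs (p%:R ^+ (s + 1) * g (s + r + 1)%N m) (Ssum A r a K s p m).
Proof.
move=> a m s r K ap.
have absP : nonarch_abs abs.
  by case: Om_p => [Qp [? [? [Qpb [? [? [? [_ _ _ _ []]]]]]]]].
have ap' : (a < p)%N by have := prime_gt0 p_prime; lia.
rewrite !addn1 [(s + r)%N]addnC.
exact: (Ssum_bound p_prime absP A_neq0 g_neq0 g_int hi hii hiii_ge hiii_lt hiv).
Qed.
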